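(* Let $F:\mathsf{Comp}\to\mathsf{Comp}$ be a functional functor and $X$ a compact Hausdorff space. The following conditions are equivalent: (1) $X$ is $F$-Milutin; (2) there exist a continuous surjective map $f:K\to X$ from a Cantor cube $K=\{0,1\}^\kappa$ and a continuous map $s:X\to FK$ such that $Ff\circ s(x)=\delta_X(x)$ for every $x\in X$.
   Context: $\mathsf{Comp}$ is the category of compact Hausdorff spaces and continuous maps. For a compact Hausdorff space $X$, $C(X)$ is the space of continuous real-valued functions on $X$ and $\mathbb R^{C(X)}$ is the space of all (arbitrary) functions $\mu:C(X)\to\mathbb R$ with the Tychonoff product topology. A continuous map $f:X\to Y$ induces $f^*:C(Y)\to C(X)$, $f^*(\varphi)=\varphi\circ f$, and $f^{**}:\mathbb R^{C(X)}\to\mathbb R^{C(Y)}$, $f^{**}(\mu)(\varphi)=\mu(\varphi\circ f)$; this makes $\mathbb R^{C(\cdot)}$ a covariant functor to Tychonoff spaces. For $x\in X$, $\delta_X(x)\in\mathbb R^{C(X)}$ is the functional $\varphi\mapsto\varphi(x)$. A functional functor is a functor $F:\mathsf{Comp}\to\mathsf{Comp}$ which is a subfunctor of $\mathbb R^{C(\cdot)}$ (so $FX\subset\mathbb R^{C(X)}$ is a compact subspace for each $X$, and $Ff=f^{**}|FX$ maps $FX$ into $FY$) and such that $\delta_X(x)\in FX$ for every compact $X$ and $x\in X$. An operator $u:C(X)\to C(Y)$ is any function (not necessarily linear or continuous). It is $F$-regular if for every $y\in Y$ the functional $\varphi\mapsto u(\varphi)(y)$ on $C(X)$ belongs to $FX$.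 For a surjective map $f:X\to Y$, an averaging operator for $f$ is an operator $u:C(X)\to C(Y)$ with $u\circ f^*=\mathrm{id}_{C(Y)}$. $X$ is $F$-Milutin if there is a continuous surjective map $f:K\to X$ from a Cantor cube $K=\{0,1\}^\kappa$ ($\kappa$ a cardinal) admitting an $F$-regular averaging operator $u:C(K)\to C(X)$. *)

(* Defs.v *)
From HB Require Import structures.
From mathcomp Require Import all_boot all_order all_algebra.
From mathcomp Require Import all_classical reals topology.

Set Implicit Arguments.
Unset Strict Implicit.
Unset Printing Implicit Defensive.

Import Order.TTheory GRing.Theory Num.Theory.
Import numFieldTopology.Exports.

Local Open Scope classical_set_scope.
Local Open Scope ring_scope.

HB.mixin Record Topological_isCompactHausdorff T & Topological T := {
  compact_setT : compact [set: T];
  hausdorffT : hausdorff_space T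
}.

#[short(type="compHausType")]
HB.structure Definition CompactHausdorff :=
  {T of Topological T & Topological_isCompactHausdorff T}.

(* The Cantor cube {0,1}^kappa, the cardinal kappa being given by a type I. *)
Definition cantor_cube (I : Type) : Type := {ptws I -> bool}.

HB.instance Definition _ (I : Type) := Topological.on (cantor_cube I).

Lemma cantor_cube_compact (I : Type) : compact [set: cantor_cube I].
Proof.
have := @tychonoff {classic I} (fun=> bool) _ (fun=> bool_compact).
by congr (compact _); rewrite eqEsubset.
Qed.

Lemma cantor_cube_hausdorff (I : Type) : hausdorff_space (cantor_cube I).
Proof.
apply: (@hausdorff_product {classic I} (fun=> bool)) => _.
exact: discrete_hausdorff.
Qed.

HB.instance Definition _ (I : Type) :=
  Topological_isCompactHausdorff.Build (cantor_cube I)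
    (@cantor_cube_compact I) (@cantor_cube_hausdorff I).

Lemma ptws_continuous (I : Type) (S T : topologicalType)
    (g : S -> {ptws I -> T}) :
  (forall i, continuous (fun s => g s i)) -> continuous g.
Proof.
move=> cg s; rewrite /continuous_at; apply/(@cvg_sup (I -> T) I) => i.
move=> A [_ [[V oV <-] Vgs] VA].
by apply: (filterS VA); apply: (cg i s); exact: open_nbhs_nbhs.
Qed.

Lemma ptws_eval_continuous (I : Type) (T : topologicalType) (i : I) :
  continuous (fun g : {ptws I -> T} => g i).
Proof. exact: (@proj_continuous {classic I} (fun=> T) i). Qed.

Section Functionals.
Variable R : realType.

(* R^C(X), with the product topology; C(X) is [continuousType X R]. *)
Definition functional (X : topologicalType) : Type :=
  {ptws continuousType X R -> R}.

HB.instance Definition _ (X : topologicalType) :=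
  Topological.on (functional X).

Definition delta (X : topologicalType) (x : X) : functional X :=
  fun phi => phi x.

(* f^* *)
Definition pullback (X Y : topologicalType) (f : continuousType X Y)
  (phi : continuousType Y R) : continuousType X R := phi \o f.

(* f^** *)
Definition pushforward (X Y : topologicalType) (f : continuousType X Y)
  (mu : functional X) : functional Y := fun phi => mu (pullback f phi).

Lemma functional_continuous (S X : topologicalType) (g : S -> functional X) :
  (forall phi, continuous (fun s => g s phi : R)) -> continuous g.
Proof. exact: ptws_continuous. Qed.

Lemma functional_eval_continuous (X : topologicalType)
    (phi : continuousType X R) :
  continuous (fun mu : functional X => mu phi : R).
Proof. exact: ptws_eval_continuous. Qed.

Lemma pushforward_continuous (X Y : topologicalType)
  (f : continuousType X Y) : continuous (pushforward f).
Proof.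
apply: functional_continuous => phi.
by have := @functional_eval_continuous X (pullback f phi).
Qed.

(* A functional functor is determined by the subspaces FX of R^C(X): its action
   on maps is the restriction of f^** (see fmor below). *)
Record functionalFunctor := FunctionalFunctor {
  carrier : forall X : compHausType, set (functional X);
  carrier_compact : forall X : compHausType, compact (@carrier X);
  carrier_pushforward : forall (X Y : compHausType) (f : continuousType X Y) mu,
    carrier mu -> carrier (pushforward f mu);
  carrier_delta : forall (X : compHausType) (x : X), @carrier X (delta x)
}.

End Functionals.

Arguments delta {R X} x.
Arguments carrier {R} _ _ _.

Section FunctorAction.
Variables (R : realType) (F : functionalFunctor R).

(* FX as a space, with the topology induced by R^C(X). *)
Definition fobj (X : compHausType) : Type := set_type (carrier F X).

HB.instance Definition _ (X : compHausType) := Topological.on (fobj X).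

Definition finj (X : compHausType) : fobj X -> functional R X := set_val.

Lemma finj_continuous (X : compHausType) : continuous (@finj X).
Proof. exact: initial_continuous. Qed.

Lemma finj_inj (X : compHausType) : injective (@finj X).
Proof. exact: val_inj. Qed.

Lemma functional_hausdorff (X : topologicalType) :
  hausdorff_space (functional R X).
Proof.
apply: (@hausdorff_product {classic (continuousType X R)} (fun=> R)) => _.
exact: order_hausdorff.
Qed.

Lemma fobj_hausdorff (X : compHausType) : hausdorff_space (fobj X).
Proof.
move=> p q pq; apply/finj_inj/functional_hausdorff => A B Ap Bq.
have [r [Ar Br]] :=
  pq _ _ (@finj_continuous X p A Ap) (@finj_continuous X q B Bq).
by exists (finj r).
Qed.

Lemma fobj_compact (X : compHausType) : compact [set: fobj X].
Proof.
move=> U PU _.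
have UF : (@finj X @ U) (carrier F X).
  by apply: (@filterS _ U _ setT) => [mu _|]; [exact: set_valP|exact: filterT].
have [mu [Fmu Umu]] := @carrier_compact R F X _ (fmap_proper_filter _ PU) UF.
exists (SigSub (mem_set Fmu)); split=> // A B UA [_ [/= [V oV <-] Vmu VB]].
have [||_ [[nu Anu <-] Vnu]] := Umu (@finj X @` A) V.
- by apply: (@filterS _ U _ A) => // nu Anu; exists nu.
- exact: open_nbhs_nbhs.
- by exists nu; split=> //; exact: VB.
Qed.

HB.instance Definition _ (X : compHausType) :=
  Topological_isCompactHausdorff.Build (fobj X)
    (@fobj_compact X) (@fobj_hausdorff X).

Section Morphisms.
Variables (X Y : compHausType) (f : continuousType X Y).

(* Ff : FX -> FY, the restriction of f^**. *)
Definition fmor (mu : fobj X) : fobj Y :=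
  SigSub (mem_set (carrier_pushforward f (set_valP mu))).

Lemma finj_fmor (mu : fobj X) : finj (fmor mu) = pushforward f (finj mu).
Proof. by []. Qed.

Lemma fmor_continuous : continuous fmor.
Proof.
move=> mu A [_ [[V oV <-] Vmu] VA].
have : nbhs (pushforward f (finj mu)) V by exact: open_nbhs_nbhs.
move=> /pushforward_continuous /finj_continuous.
by apply: (@filterS _ (nbhs mu)) => nu Vnu; exact: VA.
Qed.

HB.instance Definition _ :=
  @isContinuous.Build (fobj X) (fobj Y) fmor fmor_continuous.

End Morphisms.

Lemma fmor_id (X : compHausType) : fmor (idfun : continuousType X X) = id.
Proof.
apply/funext => mu; apply: finj_inj; apply/funext => phi.
by congr (finj mu _); exact/continuousEP.
Qed.

Lemma fmor_comp (X Y Z : compHausType) (f : continuousType X Y)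
    (g : continuousType Y Z) :
  fmor (g \o f : continuousType X Z) = fmor g \o fmor f.
Proof.
apply/funext => mu; apply: finj_inj; apply/funext => phi.
by congr (finj mu _); exact/continuousEP.
Qed.

End FunctorAction.

Section Operators.
Variables (R : realType) (X Y : compHausType).

Definition F_regular (F : functionalFunctor R)
    (u : continuousType X R -> continuousType Y R) :=
  forall y : Y, carrier F X (fun phi => u phi y).

Definition averaging_operator (f : continuousType X Y)
    (u : continuousType X R -> continuousType Y R) :=
  u \o pullback f = id.

End Operators.

Definition Milutin (R : realType) (F : functionalFunctor R)
    (X : compHausType) : Prop :=
  exists (I : Type) (f : continuousType (cantor_cube I) X),
    set_surj [set: cantor_cube I] [set: X] f /\
    exists u : continuousType (cantor_cube I) R -> continuousType X R,
      averaging_operator f u /\ F_regular F u.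

(* Main.v *)
From HB Require Import structures.
Require Import Defs.
From mathcomp Require Import all_boot all_order all_algebra.
From mathcomp Require Import all_classical reals topology.
Import numFieldTopology.Exports.

Local Open Scope classical_set_scope.

(** An [F]-regular operator [u : C(K) -> C(X)] is the same thing as a continuous
    map [s : X -> FK]: exchange the arguments in [u phi x = s x phi].  Under this
    correspondence [u (phi \o f) = phi] for all [phi] says exactly that
    [f^** (s x) = delta x] for all [x]. *)

(** [fobj F X] carries the topology induced by the product topology of R^C(X), so continuity into it
    can be tested one coordinate [phi] at a time. *)
Lemma fobj_continuous (R : realType) (F : functionalFunctor R)
    (S : topologicalType) (X : compHausType) (s : S -> fobj F X) :
  (forall phi, continuous (fun y => finj (s y) phi : R)) -> continuous s.
Proof.
(* The neighbourhood [A] of [s y] contains the trace on FX of an open set [V] of R^C(X). *)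
move=> cs y A [_ [[V oV <-] Vsy] VA].
have cfs : continuous (fun z => finj (s z)) by exact: functional_continuous.
apply: (@filterS _ (nbhs y)) (cfs y V (open_nbhs_nbhs (conj oV Vsy))) => z Vz.
exact: VA.
Qed.

(** Regularity places the functional [u phi x] of [phi] in FK; continuity in [x] is that of each
    function [u phi]. *)
Lemma regular_operator_section (R : realType) (F : functionalFunctor R)
    (K X : compHausType) (u : continuousType K R -> continuousType X R) :
  F_regular F u ->
  exists s : continuousType X (fobj F K), forall x phi, finj (s x) phi = u phi x.
Proof.
move=> uF; pose s x : fobj F K := SigSub (mem_set (uF x)).
have cs : continuous s.
  by apply: fobj_continuous => phi; exact: (@cts_fun _ _ (u phi)).
pose sC := isContinuous.Build _ _ s cs.
by exists (HB.pack_for (continuousType X (fobj F K)) s sC).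
Qed.

(** Evaluation at [phi] is continuous on FK, so composing it with [s] gives an element of C(X);
    regularity holds because [s] takes values in FK. *)
Lemma section_regular_operator (R : realType) (F : functionalFunctor R)
    (K X : compHausType) (s : continuousType X (fobj F K)) :
  exists2 u : continuousType K R -> continuousType X R,
    F_regular F u & forall x phi, finj (s x) phi = u phi x.
Proof.
have cu (phi : continuousType K R) : continuous (fun x => finj (s x) phi : R).
  move=> x; apply: (continuous_comp (f := s) (g := fun mu => finj mu phi)).
    exact: cts_fun.
  apply: (continuous_comp (f := @finj R F K) (g := fun mu => mu phi)).
    exact: finj_continuous.
  exact: functional_eval_continuous.
pose uC phi := isContinuous.Build _ _ _ (cu phi).
exists (fun phi => HB.pack_for (continuousType X R)
  (fun x => finj (s x) phi : R) (uC phi)) => // x.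
exact: set_valP (s x).
Qed.

Lemma averaging_operatorP (R : realType) (F : functionalFunctor R)
    (K X : compHausType) (f : continuousType K X)
    (u : continuousType K R -> continuousType X R)
    (s : continuousType X (fobj F K)) :
  (forall x phi, finj (s x) phi = u phi x) ->
  averaging_operator f u <-> forall x, finj (fmor f (s x)) = delta x.
Proof.
move=> su; split=> [uf x|sf].
  apply/funext => phi; rewrite finj_fmor /pushforward su.
  by have /(congr1 (fun v => v phi)) /= -> := uf.
apply/funext => phi; apply/continuousEP => x /=.
(* By conversion, the value of [s x] at [pullback f phi] is the value of Ff(s x) at [phi]. *)
by rewrite -su -[LHS]/(finj (fmor f (s x)) phi) sf.
Qed.

Theorem theorem2p4 (R : realType) (F : functionalFunctor R)
    (X : compHausType) :
  Milutin F X <->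
  exists (I : Type) (f : continuousType (cantor_cube I) X),
    set_surj [set: cantor_cube I] [set: X] f /\
    exists s : continuousType X (fobj F (cantor_cube I)),
      forall x : X, finj (fmor f (s x)) = delta x.
Proof.
split=> -[I [f [fsurj]]].
  move=> [u [uf /regular_operator_section [s su]]].
  by exists I, f; split=> //; exists s; exact/(averaging_operatorP _ _ _ _ _ _ _ su).
move=> [s sf]; have [u uF su] := section_regular_operator _ _ _ _ s.
exists I, f; split=> //; exists u; split=> //.
exact/(averaging_operatorP _ _ _ _ _ _ _ su).
Qed.
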